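(* Let $A\in\mathcal{S}_{N,p}$ be a symmetric $p$-semiseparable matrix with Givens-vector representation $\boldsymbol c_i,\boldsymbol s_i,\hat{\boldsymbol\nu}_i\in\mathbb{R}^p$ ($i=1,\dots,N$), let $S_i=\operatorname{diag}(\boldsymbol s_i)$, and let $D=\operatorname{diag}(d_1,\dots,d_N)$ with $d_i\ge0$. Suppose $A+D$ is positive definite. Then the Cholesky factor $L$ of $A+D=LL^T$ (lower triangular with positive diagonal) has entries $$L(i,j)=\begin{cases}\boldsymbol c_i^T\,S^{>}_{i-1:j}\,\boldsymbol w_j,&1\le j<i\le N,\\ f_i,&1\le i=j\le N,\end{cases}$$ where $f_i>0$ and $\boldsymbol w_i\in\mathbb{R}^p$ satisfy the recursive relations $$f_i=\sqrt{\boldsymbol c_i^T(\hat{\boldsymbol\nu}_i-P_i\boldsymbol c_i)+d_i},\quad i=1,\dots,N,$$ $$\boldsymbol w_i=(\hat{\boldsymbol\nu}_i-P_i\boldsymbol c_i)/f_i,\quad i=1,\dots,N-1,$$ with $P_1=\boldsymbol 0_{p\times p}$ and $P_i=S_{i-1}(\boldsymbol w_{i-1}\boldsymbol w_{i-1}^T+P_{i-1})S_{i-1}$ for $i=2,\dots,N$.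
   Context: For a sequence of $p\times p$ matrices, $S^{>}_{i:j}=S_iS_{i-1}\cdots S_j$ for $i\ge j$ and $S^{>}_{i:j}=I_p$ for $i<j$. Definition of $\mathcal{S}_{N,p}$: a symmetric matrix $A\in\mathbb{R}^{N\times N}$ is $p$-semiseparable ($A\in\mathcal{S}_{N,p}$) if $\operatorname{rank}(A(i:N,1:i))\le p$ for all $i=1,\dots,N$, with equality for at least one $i$. Here $A(i:N,1:i)$ is the submatrix of rows $i,\dots,N$ and columns $1,\dots,i$. Givens-vector representation (GvR): vectors $\boldsymbol c_i,\boldsymbol s_i,\hat{\boldsymbol\nu}_i\in\mathbb{R}^p$ ($i=1,\dots,N$), with components $c_{i,k},s_{i,k},\hat\nu_{i,k}$, form a GvR of a symmetric $A$ if $c_{i,k}^2+s_{i,k}^2=1$ for all $i\le N-1$, $k\le p$, with the convention $c_{N,k}=1$, $s_{N,k}=0$, and, with $S_i=\operatorname{diag}(\boldsymbol s_i)$, $$A(i,j)=\boldsymbol c_i^TS^{>}_{i-1:j}\hat{\boldsymbol\nu}_j\quad(1\le j\le i\le N),\qquad A(i,j)=\boldsymbol c_j^TS^{>}_{j-1:i}\hat{\boldsymbol\nu}_i\quad(1\le i<j\le N).$$ *)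

(* Defs.v *)
From mathcomp Require Export all_boot all_order all_algebra.

Set Implicit Arguments.
Unset Strict Implicit.
Unset Printing Implicit Defensive.

Import Order.TTheory GRing.Theory Num.Theory.
Local Open Scope ring_scope.

(* All indices are shifted down by one with respect to the usual 1-based
   numbering: 'I_N stands for {1, ..., N}, and i.+1 < N for "i <= N - 1". *)

(* The index i + a of 'I_N, for a < N - i. *)
Definition tail_ord (N : nat) (i : 'I_N) (a : 'I_(N - i)) : 'I_N :=
  cast_ord (subnKC (ltnW (ltn_ord i))) (rshift i a).

(* A(i:N, 1:i): rows i, ..., N and columns 1, ..., i of A. *)
Definition lower_block (R : rcfType) (N : nat) (A : 'M[R]_N) (i : 'I_N) :
    'M[R]_(N - i, i.+1) :=
  mxsub (@tail_ord N i) (widen_ord (ltn_ord i)) A.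

Definition semiseparable (R : rcfType) (N p : nat) (A : 'M[R]_N) : Prop :=
  [/\ A^T = A,
      forall i : 'I_N, (\rank (lower_block A i) <= p)%N
    & exists i : 'I_N, \rank (lower_block A i) = p].

(* S_{i-1} S_{i-2} ... S_j (decreasing indices, upper bound i excluded), which
   is the identity when i <= j; this is S^>_{i-1:j}. Excluding the upper bound
   avoids the predecessor of index 0. *)
Definition prod_desc (R : rcfType) (N p : nat) (S : 'I_N -> 'M[R]_p)
    (i j : 'I_N) : 'M[R]_p :=
  \big[mulmx/1%:M]_(k <- rev (enum 'I_N) | (j <= k < i)%N) S k.

(* diag_mx expects a row vector. *)
Definition diagc (R : rcfType) (p : nat) (v : 'cV[R]_p) : 'M[R]_p :=
  diag_mx v^T.

Definition GvR (R : rcfType) (N p : nat) (A : 'M[R]_N)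
    (c s nu : 'I_N -> 'cV[R]_p) : Prop :=
  let S := fun i => diagc (s i) in
  [/\ forall (i : 'I_N) (k : 'I_p), (i.+1 < N)%N ->
        c i k 0 ^+ 2 + s i k 0 ^+ 2 = 1,
      forall (i : 'I_N) (k : 'I_p), i.+1 = N -> c i k 0 = 1 /\ s i k 0 = 0,
      forall i j : 'I_N, (j <= i)%N ->
        A i j = ((c i)^T *m prod_desc S i j *m nu j) 0 0
    & forall i j : 'I_N, (i < j)%N ->
        A i j = ((c j)^T *m prod_desc S j i *m nu i) 0 0].

Definition posdefmx (R : rcfType) (N : nat) (M : 'M[R]_N) : Prop :=
  M^T = M /\ forall x : 'cV[R]_N, x != 0 -> 0 < (x^T *m M *m x) 0 0.

(* is_trig_mx is lower triangularity. *)
Definition cholesky_factor (R : rcfType) (N : nat) (M L : 'M[R]_N) : Prop :=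
  [/\ is_trig_mx L, forall i, 0 < L i i & M = L *m L^T].

(* Main.v *)
(** Comparing the entries (i, j) with j <= i of [A + D = L L^T] gives
    [L i j * L j j = (A + D) i j - \sum_(k < j) L i k * L j k]. The matrices [P]
    are designed so that [\sum_(k < j) L i k * L i' k] is the bilinear form
    [c_i^T (S_{i-1} ... S_j) P_j (S_{i'-1} ... S_j)^T c_i'] for all [i, i' >= j];
    an induction on the column index [j] then reads the entries of [L] off the
    Givens-vector representation of [A]. *)
Require Import Defs.
From mathcomp Require Import all_boot all_order all_algebra.

Set Implicit Arguments.
Unset Strict Implicit.
Unset Printing Implicit Defensive.

Import Order.TTheory GRing.Theory Num.Theory.
Local Open Scope ring_scope.

Lemma ord_recursion (T : Type) (N : nat) (x0 : T) (step : 'I_N -> T -> T) :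
  exists P : 'I_N -> T, (forall i : 'I_N, i = 0%N :> nat -> P i = x0) /\
    (forall i j : 'I_N, i = j.+1 :> nat -> P i = step j (P j)).
Proof.
(* [insub m] turns the predecessor back into an ordinal for [step]; its fallback [x0] occurs only
   for [m >= N], hence never below an index of ['I_N]. *)
pose fix Q n := if n is m.+1 then
  (if insub m is Some j then step j (Q m) else x0) else x0.
exists (fun i : 'I_N => Q i); split=> [i -> //|i j ->] /=.
by rewrite valK.
Qed.

Lemma prod_desc_id (R : rcfType) (N p : nat) (S : 'I_N -> 'M[R]_p) (i : 'I_N) :
  prod_desc S i i = 1%:M.
Proof. by rewrite /prod_desc big_pred0 // => k; case: ltngtP. Qed.

(** The smallest index gives the rightmost factor. Splitting it off supplies the [S j] on either
    side in the recursion for [P]. *)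
Lemma prod_desc_recr (R : rcfType) (N p : nat) (S : 'I_N -> 'M[R]_p)
    (i j j1 : 'I_N) :
  j1 = j.+1 :> nat -> (j < i)%N ->
  prod_desc S i j = prod_desc S i j1 *m S j.
Proof.
move=> ej1 ltji; rewrite /prod_desc -!(big_filter (rev _)) !filter_rev.
have enum_sorted :
    sorted (relpre (val : 'I_N -> nat) ltn) (enum 'I_N).
  by have := iota_ltn_sorted 0 N; rewrite -val_enum_ord sorted_map.
have ltr : transitive (relpre (val : 'I_N -> nat) ltn).
  by move=> x y z; apply: ltn_trans.
(* Both lists are strictly increasing and have the same members, so they coincide. *)
have -> : [seq k : 'I_N <- enum 'I_N | (j <= k < i)%N]
        = j :: [seq k : 'I_N <- enum 'I_N | (j1 <= k < i)%N].
  apply: (irr_sorted_eq ltr) => [x /=|||x]; first by rewrite /= ltnn.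
  - exact: sorted_filter.
  - rewrite /= path_min_sorted; first exact: sorted_filter.
    by apply/allP=> x; rewrite mem_filter ej1 => /andP[/andP[]].
  rewrite inE !(mem_filter _ x (enum _)) mem_enum ej1 !andbT -val_eqE.
  by case: (ltngtP j x) => //= <-.
rewrite rev_cons -cats1; elim: (rev _) => [|k r IHr].
  by rewrite big_cons !big_nil mulmx1 mul1mx.
by rewrite cat_cons !big_cons IHr mulmxA.
Qed.

Lemma mulmx_trig_tr (R : rcfType) (N : nat) (L : 'M[R]_N) (i j : 'I_N) :
  is_trig_mx L ->
  (L *m L^T) i j = \sum_(k < N | (k < j)%N) L i k * L j k + L i j * L j j.
Proof.
move=> /is_trig_mxP Ltrig; rewrite mxE.
rewrite (bigID (fun k : 'I_N => (k < j)%N)) /=; congr (_ + _).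
  by apply: eq_bigr => k _; rewrite mxE.
rewrite (bigD1 j) ?ltnn //= mxE big1 ?addr0 // => k /andP[].
by rewrite -leqNgt leq_eqVlt mxE -val_eqE /= eq_sym => /predU1P[->|/Ltrig ->];
  rewrite ?eqxx ?mulr0.
Qed.

(** Induction on columns: once the columns before [j] agree, so do all products [L k j * L j j]. The
    case [k = j] compares squares of positive numbers and gives equal diagonals, by which one then
    divides. *)
Lemma cholesky_factor_unique (R : rcfType) (N : nat) (M L L' : 'M[R]_N) :
  cholesky_factor M L -> cholesky_factor M L' -> L = L'.
Proof.
move=> [Lt Lp ->] [Lt' Lp' eqLL].
suff eqcol n : forall i j : 'I_N, (j < n)%N -> L i j = L' i j.
  by apply/matrixP=> i j; apply: (eqcol N).
elim: n => // n IHn i j; rewrite ltnS leq_eqVlt => /predU1P[ejn|]; last exact: IHn.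
have eqprod k : L k j * L j j = L' k j * L' j j.
  have := congr1 (fun X : 'M_N => X k j) eqLL.
  rewrite !mulmx_trig_tr // => /eqP.
  rewrite (eq_bigr (fun l => L' k l * L' j l)) => [/eqP/addrI //|l].
  by rewrite ejn => ltln; rewrite !IHn.
have eqdiag : L j j = L' j j.
  apply/eqP; rewrite -(@eqrXn2 _ 2) ?ltW //.
  by rewrite !expr2 eqprod.
have := eqprod i; rewrite eqdiag; apply: mulIf.
by rewrite gt_eqF.
Qed.

(** The vector [y] solves [M 0 0 *: y + b^T *m x = 0], which kills the first block of the product
    and leaves the Schur complement of [M 0 0]. This carries positive definiteness over to the Schur
    complement. *)
Lemma schur_form (R : rcfType) (n : nat) (M : 'M[R]_(1 + n)) (x : 'cV[R]_n) :
  M^T = M -> M 0 0 != 0 ->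
  let b := dlsubmx M in
  let y := - (M 0 0)^-1 *: (b^T *m x) in
  ((col_mx y x)^T *m M *m col_mx y x) 0 0 =
  (x^T *m (drsubmx M - (M 0 0)^-1 *: (b *m b^T)) *m x) 0 0.
Proof.
move=> Msym a0 b y.
have ulE : ulsubmx M = (M 0 0)%:M.
  rewrite [LHS]mx11_scalar; congr (_%:M).
  by rewrite !mxE; congr (M _ _); apply/val_inj.
have urE : ursubmx M = b^T by rewrite /b trmx_dlsub Msym.
rewrite -{1}(submxK M) ulE urE -/b tr_col_mx mul_row_block mul_row_col.
have -> : y^T *m (M 0 0)%:M = - (x^T *m b).
  rewrite /y -scalemx1 -scalemxAr mulmx1 linearZ /= trmx_mul trmxK.
  by rewrite scalerA mulrN divff // scaleN1r.
rewrite addNr mul0mx add0r.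
congr ((_ : 'M_(_, _)) 0 0).
rewrite mulmxDl mulmxBr mulmxBl addrC; congr (_ + _).
rewrite /y linearZ /= trmx_mul trmxK -scalemxAr -!scalemxAl scaleNr.
by rewrite !mulmxA.
Qed.

(** One elimination step per size: with [a] the corner and [b] the column below it, the first column
    of the factor is [sqrt a] above [b / sqrt a], and the rest is a factor [L'] of the Schur
    complement. *)
Lemma cholesky_factor_exists (R : rcfType) (N : nat) (M : 'M[R]_N) :
  posdefmx M -> exists L, cholesky_factor M L.
Proof.
elim: N M => [|n IHn] M; first by exists 0; split;
  [apply/is_trig_mxP=> -[] | case | apply/matrixP=> -[]].
rewrite -[n.+1]/(1 + n)%N in M * => -[Msym Mpos].
pose a := M 0 0; pose b := dlsubmx M.
have a_gt0 : 0 < a.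
  (* The corner is the value of the quadratic form at the first basis vector. *)
  have := Mpos (delta_mx 0 0) _; rewrite trmx_delta -rowE -colE !mxE; apply.
  by apply/eqP=> /matrixP/(_ 0 0)/eqP; rewrite !mxE !eqxx oner_eq0.
have a_neq0 : a != 0 by rewrite gt_eqF.
have [|L' [L't L'p L'E]] := IHn (drsubmx M - a^-1 *: (b *m b^T)).
  split=> [|x x0].
    by rewrite linearB linearZ /= trmx_mul trmxK trmx_drsub Msym.
  rewrite -schur_form //; apply: Mpos.
  by apply: contraNneq x0 => /eqP; rewrite col_mx_eq0 => /andP[].
pose r := Num.sqrt a.
have r_gt0 : 0 < r by rewrite sqrtr_gt0.
have rr : r * r = a by rewrite -expr2 sqr_sqrtr // ltW.
exists (block_mx r%:M 0 (r^-1 *: b) L'); split.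
- by rewrite is_trig_block_mx // mx11_is_trig eqxx L't.
- move=> i; rewrite -(splitK i); case: (split i) => k /=.
    by rewrite block_mxEul ord1 mxE.
  by rewrite block_mxEdr.
have rVr : r * r^-1 = 1 by rewrite mulfV ?gt_eqF.
have -> : block_mx r%:M 0 (r^-1 *: b) L' *m (block_mx r%:M 0 (r^-1 *: b) L')^T =
    block_mx a%:M b^T b (drsubmx M).
  rewrite tr_block_mx mulmx_block trmx0 !mul0mx !mulmx0 !addr0 -L'E.
  rewrite tr_scalar_mx -scalar_mxM rr mul_scalar_mx mul_mx_scalar.
  rewrite [(_ *: b)^T]linearZ /= !scalerA rVr !scale1r.
  by rewrite -scalemxAl -scalemxAr scalerA -invfM rr addrC subrK.
rewrite -[LHS]submxK; congr block_mx.
  rewrite [LHS]mx11_scalar; congr (_%:M).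
  by rewrite !mxE; congr (M _ _); apply/val_inj.
by rewrite /b trmx_dlsub Msym.
Qed.

Section GivensVectorCholesky.

Variables (R : rcfType) (N p : nat) (A : 'M[R]_N).
Variables (c s nu : 'I_N -> 'cV[R]_p) (d : 'rV[R]_N).
Variables (L : 'M[R]_N) (w : 'I_N -> 'cV[R]_p) (P : 'I_N -> 'M[R]_p).
Let S i := diagc (s i).

Hypothesis hGvR : GvR A c s nu.
Hypothesis hL : cholesky_factor (A + diag_mx d) L.
Hypothesis wE : forall i, w i = (L i i)^-1 *: (nu i - P i *m c i).
Hypothesis P0 : forall i : 'I_N, i = 0%N :> nat -> P i = 0.
Hypothesis PS : forall i j : 'I_N, i = j.+1 :> nat ->
  P i = S j *m (w j *m (w j)^T + P j) *m S j.

Let partial_gram (j : 'I_N) := forall i i' : 'I_N, (j <= i)%N -> (j <= i')%N ->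
  \sum_(k < N | (k < j)%N) L i k * L i' k =
  ((c i)^T *m prod_desc S i j *m P j *m ((c i')^T *m prod_desc S i' j)^T) 0 0.

(** Taking [i' = j] in the Gram identity makes the second product the identity, so the sum over
    [k < j] has the same left factor as the representation of [A i j], and the two combine into
    [nu j - P j *m c j]. *)
Lemma cholesky_entry_of_partial_gram (i j : 'I_N) :
  partial_gram j -> (j <= i)%N ->
  L i j * L j j =
  ((c i)^T *m prod_desc S i j *m (nu j - P j *m c j)) 0 0 + d 0 j *+ (i == j).
Proof.
case: hGvR => _ _ AE _; case: hL => Lt _ LE gram leji.
have := congr1 (fun X : 'M_N => X i j) LE.
rewrite mulmx_trig_tr // gram // prod_desc_id mulmx1 trmxK.
rewrite [LHS]mxE [diag_mx _ _ _]mxE AE // -/S => entryE.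
have subE (X Y : 'M[R]_1) : (X - Y) 0 0 = X 0 0 - Y 0 0 by rewrite !mxE.
rewrite mulmxBr !mulmxA subE.
have -> : d 0 j *+ (i == j) = d 0 i *+ (i == j) by case: eqVneq => // ->.
by rewrite addrAC entryE addrC addKr.
Qed.

Lemma cholesky_entry_below (i j : 'I_N) :
  partial_gram j -> (j < i)%N ->
  L i j = ((c i)^T *m prod_desc S i j *m w j) 0 0.
Proof.
move=> gram ltji; case: hL => _ Lp _.
have Ljj : L j j != 0 by rewrite gt_eqF.
apply: (mulIf Ljj); rewrite cholesky_entry_of_partial_gram ?(ltnW ltji) //.
rewrite -val_eqE /= (gtn_eqF ltji) addr0 wE -scalemxAr [in RHS]mxE.
by rewrite mulrAC mulVf ?mul1r.
Qed.

(** Passing from [j] to [j + 1] adds the term [L i j * L i' j], a product of two linear forms in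
    [w j]. It contributes the rank-one update [w j *m (w j)^T] to [P j], and the factors [S j] split
    off the two products complete the recursion for [P]. *)
Lemma cholesky_partial_gram (j : 'I_N) : partial_gram j.
Proof.
case: j => n; elim: n => [|n IHn] ltnN i i' lei lei'.
  by rewrite P0 // mulmx0 mul0mx mxE big_pred0.
pose j := Ordinal (ltnW ltnN); pose j1 := Ordinal ltnN.
have gram : partial_gram j := IHn _.
rewrite (bigD1 j) //= (eq_bigl (fun k : 'I_N => (k < j)%N)); last first.
  by move=> k; rewrite -val_eqE /= ltnS; case: ltngtP.
rewrite gram ?(ltnW lei) ?(ltnW lei') // !cholesky_entry_below //.
rewrite !(@prod_desc_recr _ _ _ _ _ j j1) // (@PS j1 j) // !mulmxA.
set u := (c i)^T *m _; set u' := (c i')^T *m _.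
have -> : u *m S j *m (w j *m (w j)^T + P j) *m S j *m u'^T =
    u *m S j *m w j *m (u' *m S j *m w j)^T + u *m S j *m P j *m (u' *m S j)^T.
  have ST : (S j)^T = S j by rewrite /S /diagc tr_diag_mx.
  by rewrite !trmx_mul ST mulmxDr !mulmxDl !mulmxA.
rewrite [RHS]mxE; congr (_ + _).
by rewrite [RHS]mxE big_ord1; congr (_ * _); rewrite [RHS]mxE.
Qed.

End GivensVectorCholesky.

Theorem proposition4p1 (R : rcfType) (N p : nat) (A : 'M[R]_N)
    (c s nu : 'I_N -> 'cV[R]_p) (d : 'rV[R]_N)
    (hA : semiseparable p A)
    (hGvR : GvR A c s nu)
    (hd : forall i, 0 <= d 0 i)
    (hpos : posdefmx (A + diag_mx d)) :
  let S := fun i => diagc (s i) in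
  exists L : 'M[R]_N,
    unique (cholesky_factor (A + diag_mx d)) L /\
    exists (f : 'I_N -> R) (w : 'I_N -> 'cV[R]_p) (P : 'I_N -> 'M[R]_p),
      [/\ forall i j : 'I_N, (j < i)%N ->
            L i j = ((c i)^T *m prod_desc S i j *m w j) 0 0
        & forall i : 'I_N, L i i = f i] /\
      [/\ forall i : 'I_N, 0 < f i,
          forall i : 'I_N,
            f i = Num.sqrt (((c i)^T *m (nu i - P i *m c i)) 0 0 + d 0 i),
          forall i : 'I_N, (i.+1 < N)%N ->
            w i = (f i)^-1 *: (nu i - P i *m c i),
          forall i : 'I_N, i = 0%N :> nat -> P i = 0
        & forall i j : 'I_N, i = j.+1 :> nat ->
            P i = S j *m (w j *m (w j)^T + P j) *m S j].
Proof.
move=> S; have [L hL] := cholesky_factor_exists hpos.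
exists L; split; first by split=> // L' /(cholesky_factor_unique hL).
(* The diagonal of the factor already obtained serves as [f], so [P] comes from a plain recursion
   without square roots, and [w] is a function of [P]. *)
pose w_of P i := (L i i)^-1 *: (nu i - P *m c i).
have [P [P0 PS]] := ord_recursion 0
  (fun j P => S j *m (w_of P j *m (w_of P j)^T + P) *m S j).
pose w i := w_of (P i) i.
have wE i : w i = (L i i)^-1 *: (nu i - P i *m c i) by [].
have gram j := cholesky_partial_gram hGvR hL wE P0 PS (j := j).
have [_ Lp _] := hL.
exists (fun i => L i i), w, P; split; split=> //.
  move=> i j ltji; exact: (cholesky_entry_below hGvR hL wE (@gram j)).
(* At [i = j] the entry formula computes [L i i ^+ 2]; positivity of [L i i] makes it the square
   root. *)
move=> i; have := cholesky_entry_of_partial_gram hGvR hL (@gram i) (leqnn i).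
rewrite prod_desc_id mulmx1 eqxx mulr1n => <-.
by rewrite -expr2 sqrtr_sqr gtr0_norm.
Qed.
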